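(* Let $n\geq 1$ and let $X_{1},\ldots,X_{n}$ be independent symmetric random variables with values in a separable Hilbert space $(\mathcal{H},|\cdot|)$, and let $S_k=\sum_{i=1}^k X_i$ for $1\leq k\leq n$. Then for any real numbers $a_{1},\ldots,a_{n}$ and any $t\geq 0$, \[ \mathbb{P}\Big(\max_{1\leq k\leq n}\big||S_{k}|^{2}-a_{k}\big|\geq 3t\Big)\leq 6\max_{1\leq k\leq n}\mathbb{P}\big(\big||S_{k}|^{2}-a_{k}\big|\geq t\big). \]
   Context: The random variables are defined on a common probability space with probability measure $\mathbb{P}$. A random vector $X$ is symmetric if $X$ and $-X$ have the same distribution. $|x|$ denotes the norm of $x\in\mathcal{H}$. *)

(* Defs.v *)
From HB Require Import structures.
From mathcomp Require Import all_boot all_order all_algebra sesquilinear.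
From mathcomp Require Import all_classical all_reals all_analysis.

Set Implicit Arguments.
Unset Strict Implicit.
Unset Printing Implicit Defensive.

Import Order.TTheory GRing.Theory Num.Theory.
Import numFieldNormedType.Exports.

Local Open Scope classical_set_scope.
Local Open Scope ring_scope.

(* Real scalars lose no generality: a complex Hilbert space is a real one for
   the real part of its inner product, with the same norm, hence the same
   topology and Borel sets.  Completeness is carried by the type. *)
Definition hilbert (R : realType) (H : completeNormedModType R) : Prop :=
  exists dot : {dot H for idfun}, forall x : H, `|x| ^+ 2 = dot x x.

Definition separable (T : topologicalType) : Prop :=
  exists2 D : set T, countable D & dense D.

Notation borel T := (g_sigma_algebraType (@open T)).

Definition eq_distribution (R : realType) (d d' : measure_display)
    (T : measurableType d) (T' : measurableType d') (P : probability T R)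
    (X Y : T -> T') : Prop :=
  forall B : set T', measurable B -> pushforward P X B = pushforward P Y B.

Definition symmetric_RV (R : realType) (d : measure_display)
    (T : measurableType d) (P : probability T R)
    (H : completeNormedModType R) (X : {RV P >-> borel H}) : Prop :=
  eq_distribution P X (fun w => - (X w : H) : borel H).

Definition mutually_independent (R : realType) (d d' : measure_display)
    (T : measurableType d) (T' : measurableType d') (P : probability T R)
    (I : finType) (X : I -> {RV P >-> T'}) : Prop :=
  forall (J : {set I}) (B : I -> set T'),
    (forall i, i \in J -> measurable (B i)) ->
    P (\bigcap_(i in [set` J]) X i @^-1` B i) =
    (\prod_(i in J) P (X i @^-1` B i))%E.

(* The indices 1, ..., n are encoded as 0, ..., n - 1 in 'I_n, so
   [partial_sum X k] is the sum of the first k + 1 variables. *)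
Definition partial_sum (R : realType) (d : measure_display)
    (T : measurableType d) (P : probability T R)
    (H : completeNormedModType R) (n : nat) (X : 'I_n -> {RV P >-> borel H})
    (k : 'I_n) (w : T) : H :=
  \sum_(i < n | (i <= k)%N) (X i w : H).

(* Main.v *)
Require Import Defs.
From HB Require Import structures.
From mathcomp Require Import all_boot all_order all_algebra sesquilinear.
From mathcomp Require Import all_classical all_reals all_analysis.
From mathcomp Require Import measurable_realfun ring lra.

Set Implicit Arguments.
Unset Strict Implicit.
Unset Printing Implicit Defensive.

Import Order.TTheory GRing.Theory Num.Theory.
Import numFieldNormedType.Exports.

Local Open Scope classical_set_scope.
Local Open Scope ring_scope.

(* Let p be the maximum on the right, let E_k be the event that k is the first
   index with ||S_k|^2 - a_k| >= 3t, and let Y = S_n - S_k.  As Y is symmetric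
   and independent of X_1, ..., X_k, flipping the signs of X_(k+1), ..., X_n
   preserves the joint law and replaces S_n = S_k + Y by S_k - Y.  By the
   parallelogram law
     (|S_k + Y|^2 - a_n) + (|S_k - Y|^2 - a_n)
       = 2 (|S_k|^2 - a_k) + 2 (|Y|^2 - (a_n - a_k)).
   Hence ||Y|^2 - (a_n - a_k)| >= 2t has probability at most 3p and is
   independent of E_k, while on the rest of E_k one of the two deviations on the
   left is at least t.  So P(E_k) <= 3p P(E_k) + 2 P(E_k, ||S_n|^2 - a_n| >= t),
   and summing over k gives the bound 3p + 2p. *)

(** * Borel measurability of sums in a separable normed space *)

Lemma measurable_fun_open d (W : measurableType d) (T : ptopologicalType)
    (f : W -> borel T) :
  (forall U : set T, open U -> measurable (f @^-1` U)) -> measurable_fun setT f.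
Proof.
move=> mf; apply: (@measurability _ _ _ (borel T) _ _ (@open T)) => //.
by move=> _ [U oU <-]; rewrite setTI; exact: mf.
Qed.

Section borel_normed.
Context (R : realType) (H : normedModType R).

Lemma continuous_measurable_borel (T : ptopologicalType) (f : H -> T) :
  continuous f -> measurable_fun setT (f : borel H -> borel T).
Proof.
move=> /continuousP cf; apply: measurable_fun_open => U oU.
by apply: sub_sigma_algebra; exact: cf.
Qed.

Lemma measurable_norm_borel :
  measurable_fun setT (fun x : borel H => `|x : H|%R : R).
Proof.
apply: (measurability _ (RGenOInfty.measurableE R)).
move=> _ [_ [r ->] <-]; rewrite setTI; apply: sub_sigma_algebra.
have /continuousP := @norm_continuous _ H; apply.
exact: interval_open.
Qed.

(* The Borel sets of [H * H] need not be generated by products of Borel sets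
   when [H] is not separable. *)
Lemma measurable_funD_borel d (W : measurableType d) (f g : W -> borel H) :
  separable H ->
  measurable_fun setT f -> measurable_fun setT g ->
  measurable_fun setT (fun w => (f w : H) + (g w : H) : borel H).
Proof.
move=> [D cD dD] mf mg; apply: measurable_fun_open => U oU.
(* The preimage of [U] is a countable union of rectangles: pairs of balls with centres in [D] and
   radius [1 / (m + 1)] whose sums stay in [U]. *)
pose ok (q : (H * H) * nat) := forall x y : H,
  ball q.1.1 (q.2.+1%:R^-1) x -> ball q.1.2 (q.2.+1%:R^-1) y -> U (x + y).
pose I := [set q : (H * H) * nat | [/\ D q.1.1, D q.1.2 & ok q]].
have cI : countable I.
  apply: (@sub_countable _ _ _ ((D `*` D) `*` [set: nat])).
    by apply: subset_card_le => -[[x y] m] [].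
  apply: countableX => //; first exact: countableX.
rewrite [X in measurable X](_ : _ = \bigcup_(q in I)
   ((f @^-1` ball q.1.1 (q.2.+1%:R^-1)) `&`
    (g @^-1` ball q.1.2 (q.2.+1%:R^-1)))).
  rewrite bigcup_set_type; apply: countable_bigcupT_measurable.
    by rewrite (eq_countable (card_setT _)).
  move=> -[[[x y] m] _] /=.
  apply: measurableI; rewrite -[X in measurable X]setTI.
    by apply: mf => //; apply: sub_sigma_algebra; exact: ball_open.
  by apply: mg => //; apply: sub_sigma_algebra; exact: ball_open.
apply/seteqP; split => [w /= Uw|w [q [_ _ okq] [/= ? ?]]]; last exact: okq.
have /nbhs_ballP[e /= e0 eU] : nbhs ((f w : H) + (g w : H)) U.
  exact: open_nbhs_nbhs.
(* In each summand, passing to the centre of its ball and on to another point of that ball costs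
   less than two radii, so four radii in total. *)
have [m /= me] : exists m, 4 * m.+1%:R^-1 < e.
  exists (Num.truncn (4 / e)).
  by rewrite ltr_pdivrMr// mulrC -ltr_pdivrMr// truncnS_gt.
have m0 : 0 < m.+1%:R^-1 :> R by rewrite invr_gt0.
have approx (z : H) : exists2 y, D y & ball y m.+1%:R^-1 z.
  have [y [zy Dy]] :=
    dD _ (ex_intro _ z (ballxx z m0)) (ball_open z m.+1%:R^-1).
  by exists y => //; exact: ball_sym.
have [x Dx xf] := approx (f w).
have [y Dy yg] := approx (g w).
exists ((x, y), m) => //; split => //= x' y' xx' yy'; apply: eU.
rewrite -ball_normE /= in xf yg xx' yy' *.
have -> : (f w : H) + (g w : H) - (x' + y') =
    ((x - x') - (x - f w)) + ((y - y') - (y - g w)).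
  have subBK (u v z : H) : (u - v) - (u - z) = z - v.
    by rewrite opprB addrC addrA subrK.
  by rewrite !subBK opprD addrACA.
apply: lt_trans me; rewrite (le_lt_trans (ler_normD _ _))//.
rewrite (_ : 4 * _ = (m.+1%:R^-1 + m.+1%:R^-1) + (m.+1%:R^-1 + m.+1%:R^-1)).
  by rewrite ltrD// (le_lt_trans (ler_normB _ _))// ltrD.
by move: (_^-1) => r; ring.
Qed.

Lemma measurable_sum_borel d (W : measurableType d) (I : Type) (s : seq I)
    (p : pred I) (f : I -> W -> borel H) :
  separable H -> (forall i, p i -> measurable_fun setT (f i)) ->
  measurable_fun setT (fun w => \sum_(i <- s | p i) (f i w : H) : borel H).
Proof.
move=> sH mf; elim: s => [|i s IHs].
  rewrite [X in measurable_fun _ X](_ : _ = (fun=> 0 : H)).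
    exact: measurable_cst.
  by apply/funext => w; exact: big_nil.
rewrite [X in measurable_fun _ X](_ : _ = fun w => if p i
    then (f i w : H) + \sum_(j <- s | p j) (f j w : H)
    else \sum_(j <- s | p j) (f j w : H)); last first.
  by apply/funext => w; exact: big_cons.
by case: (boolP (p i)) => // ip; apply: measurable_funD_borel => //; exact: mf.
Qed.

End borel_normed.

(** * Independence: from pi-systems to the generated sigma-algebras *)

Section independence.
Context (R : realType) d (T : measurableType d) (P : probability T R).
Implicit Types G : set (set T).

(** With [B] fixed, both sides are finite measures in [A] that agree on the pi-system [G], hence on
    the sigma-algebra it generates. *)
Lemma indep_g_sigmal G (B : set T) : G `<=` measurable -> setI_closed G ->
  G setT -> measurable B ->
  (forall A, G A -> P (A `&` B) = P A * P B)%E ->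
  forall A, <<s G >> A -> (P (A `&` B) = P A * P B)%E.
Proof.
move=> Gm GI GT mB GB A sA.
have b0 : 0 <= fine (P B) by exact: fine_ge0.
have -> : (P A * P B = mscale (NngNum b0) P A)%E.
  by rewrite /mscale/= fineK 1?muleC// fin_num_measure.
apply: (g_sigma_algebra_measure_unique G Gm (fun=> setT) _ _
  (mrestr P mB)) => //.
- by rewrite bigcup_const.
- move=> C GC /=; rewrite /mrestr /mscale/= GB// fineK 1?muleC//.
  by rewrite fin_num_measure.
- by move=> _; rewrite /= /mrestr setTI ltey_eq fin_num_measure.
Qed.

Lemma indep_g_sigma G G' :
  G `<=` measurable -> setI_closed G -> G setT ->
  G' `<=` measurable -> setI_closed G' -> G' setT ->
  (forall A B, G A -> G' B -> P (A `&` B) = P A * P B)%E ->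
  forall A B, <<s G >> A -> <<s G' >> B -> (P (A `&` B) = P A * P B)%E.
Proof.
move=> Gm GI GT G'm G'I G'T GG' A B sA sB.
have mA : measurable A.
  exact: (smallest_sub (@sigma_algebra_measurable _ T)) sA.
rewrite setIC muleC; apply: (indep_g_sigmal G'm) => // C G'C.
rewrite setIC muleC; apply: (indep_g_sigmal Gm) => //; first exact: G'm.
by move=> D GD; exact: GG'.
Qed.

End independence.

(** * Cylinder sigma-algebras on finite families *)

Section cylinders.
Context d (E : measurableType d) (I : finType).
Implicit Types (J K : {set I}) (B : I -> set E).

Definition cylinder J B : set (I -> E) :=
  [set x | forall i, i \in J -> B i (x i)].

(** These sets generate the sigma-algebra of the coordinates in [J]; measurability for it expresses
    dependence on those coordinates alone. *)
Definition cylinders J : set (set (I -> E)) :=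
  [set cylinder J B | B in [set B | forall i, measurable (B i)]].

Lemma cylinders_setI J : setI_closed (cylinders J).
Proof.
move=> _ _ [B mB <-] [C mC <-]; exists (fun i => B i `&` C i).
  by move=> i; exact: measurableI.
apply/seteqP; split => [x BC|x [Bx Cx] i iJ]; first by split => i /BC[].
by split; [exact: Bx|exact: Cx].
Qed.

Lemma cylinders_setT J : cylinders J setT.
Proof. by exists (fun=> setT) => //; apply/seteqP; split. Qed.

Lemma sub_cylinders J K : J \subset K -> cylinders J `<=` cylinders K.
Proof.
move=> /fintype.subsetP JK _ [B mB <-].
exists (fun i => if i \in J then B i else setT).
  by move=> i /=; case: ifP.
apply/seteqP; split => x /= Bx i iJ; last by case: ifPn => // /Bx.
by have := Bx i (JK i iJ); rewrite iJ.
Qed.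

Lemma measurable_coord J (i : I) : i \in J ->
  measurable_fun setT (fun x : g_sigma_algebraType (cylinders J) => x i).
Proof.
move=> iJ _ A mA; rewrite setTI; apply: sub_sigma_algebra.
exists (fun j => if j == i then A else setT).
  by move=> j /=; case: ifP.
apply/seteqP; split => x /=; first by move=> /(_ i iJ); rewrite eqxx.
by move=> Ax j jJ; case: eqP => // ->.
Qed.

Lemma measurable_family J d' (W : measurableType d') (Z : I -> W -> E) :
  (forall i, measurable_fun setT (Z i)) ->
  measurable_fun setT (fun w => Z^~ w : g_sigma_algebraType (cylinders J)).
Proof.
move=> mZ; apply: (@measurability _ _ _ (g_sigma_algebraType (cylinders J))
  _ _ (cylinders J)) => //.
move=> _ [_ [B mB <-] <-]; rewrite setTI.
rewrite [X in measurable X](_ : _ = \bigcap_(i in [set` J]) Z i @^-1` B i).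
  by apply: fin_bigcap_measurable => // i _; rewrite -[X in measurable X]setTI;
    exact: mZ.
by apply/seteqP; split.
Qed.

End cylinders.

(** * Sums over index sets and sign flips *)

Section partial_sums.
Context (R : realType) (H : completeNormedModType R) (I : finType).
Hypothesis sH : separable H.
Implicit Types (J K : {set I}) (x : I -> borel H).

Definition sum_on J x : H := \sum_(i in J) (x i : H).

Definition flip_off J x : I -> borel H :=
  fun i => if i \in J then x i else - (x i : H).

Lemma sum_on_setC J x : sum_on [set: I] x = sum_on J x + sum_on (~: J) x.
Proof.
rewrite /sum_on (bigID (mem J))/=; congr (_ + _); apply: eq_bigl => i.
  by rewrite inE.
by rewrite !inE.
Qed.

Lemma sum_on_flip J K x : K \subset J -> sum_on K (flip_off J x) = sum_on K x.
Proof.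
move=> /fintype.subsetP KJ.
by apply: eq_bigr => i iK; rewrite /flip_off KJ.
Qed.

Lemma sum_on_flipC J x : sum_on (~: J) (flip_off J x) = - sum_on (~: J) x.
Proof.
rewrite /sum_on -sumrN; apply: eq_bigr => i.
by rewrite inE /flip_off => /negbTE ->.
Qed.

(** A small [K] records which coordinates the sum depends on, which is what makes independence
    applicable; the full [K] gives plain measurability. *)
Lemma measurable_sum_on J K : J \subset K ->
  measurable_fun setT
    (sum_on J : g_sigma_algebraType (cylinders K) -> borel H).
Proof.
move=> /fintype.subsetP JK; apply: measurable_sum_borel => // i iJ.
by apply: measurable_coord; exact: JK.
Qed.

Lemma measurable_flip_off J :
  measurable_fun setT
    (flip_off J : g_sigma_algebraType (cylinders [set: I]) ->
                  g_sigma_algebraType (cylinders [set: I])).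
Proof.
apply: (@measurable_family _ (borel H) I [set: I] _
  (g_sigma_algebraType (@cylinders _ (borel H) I [set: I]))
  (fun i x => flip_off J x i)) => i.
rewrite /flip_off; case: (i \in J); first exact: measurable_coord.
apply: (measurableT_comp (continuous_measurable_borel (@oppr_continuous _ H))).
exact: measurable_coord.
Qed.

End partial_sums.

(** * Parallelogram law and deterministic deviation bounds *)

Lemma parallelogram (R : realType) (H : completeNormedModType R) :
  hilbert H ->
  forall x y : H, `|x + y| ^+ 2 + `|x - y| ^+ 2 = 2 * (`|x| ^+ 2 + `|y| ^+ 2).
Proof.
move=> [dot dotE] x y; rewrite !dotE.
rewrite !(linearDl, linearDr, linearNl, linearNr) /=.
ring.
Qed.

Section deviations.
Context (R : realFieldType).
Variables (u y v v' a b t : R).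
Hypothesis uyv : v + v' = 2 * (u + y).

(** Here [u], [y], [v], [v'] stand for the squared norms of S_k, Y, S_k + Y, S_k - Y, and [a], [b]
    for a_k, a_n. By [uyv], [2 * (y - (b - a))] equals [(v - b) + (v' - b) - 2 * (u - a)], which is
    below [4 * t] in absolute value if all three deviations are below [t]. *)
Lemma tail_deviation : 2 * t <= `|y - (b - a)| ->
  [\/ t <= `|u - a|, t <= `|v - b| | t <= `|v' - b|].
Proof.
move=> yt; case: (leP t `|u - a|) => [|ut]; first by constructor 1.
case: (leP t `|v - b|) => [|vt]; first by constructor 2.
case: (leP t `|v' - b|) => [|v't]; first by constructor 3.
move: ut vt v't yt; rewrite !ltr_norml ler_normr.
move=> /andP[? ?] /andP[? ?] /andP[? ?] /orP[?|?]; exfalso; move: uyv; lra.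
Qed.

(** By the same identity [(v - b) + (v' - b)] exceeds [6 * t - 4 * t] in absolute value, so one of
    the two terms reaches [t]. *)
Lemma exit_deviation : 3 * t <= `|u - a| -> `|y - (b - a)| < 2 * t ->
  t <= `|v - b| \/ t <= `|v' - b|.
Proof.
move=> ut yt; case: (leP t `|v - b|) => [|vt]; first by left.
case: (leP t `|v' - b|) => [|v't]; first by right.
move: ut vt v't yt; rewrite !ltr_norml ler_normr.
move=> /orP[?|?] /andP[? ?] /andP[? ?] /andP[? ?]; exfalso; move: uyv; lra.
Qed.

End deviations.

(** * The inequality for a flip-invariant law on the space of families *)

Section maximal_inequality.
Context (R : realType) (H : completeNormedModType R) (n : nat).
Hypotheses (hH : hilbert H) (sH : separable H).

Let I := 'I_n.+1.
(** On the space of families a sign flip is a map of the space to itself, so symmetry becomes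
    invariance of the measure [Q]. *)
Let space := g_sigma_algebraType (@cylinders _ (borel H) I [set: I]).

Variable Q : probability space R.
Hypothesis Qsym : forall J (A : set space),
  measurable A -> Q (flip_off J @^-1` A) = Q A.
Hypothesis Qind : forall (J : {set I}) (A B : set space),
  <<s cylinders J >> A -> <<s cylinders (~: J) >> B ->
  (Q (A `&` B) = Q A * Q B)%E.

Variables (a : I -> R) (t p : R).

Let upto (k : I) : {set I} := [set i : I | (i <= k)%N].
Let dev (k : I) (x : space) := `| `|sum_on (upto k) x| ^+ 2 - a k|.
Let tail (k : I) (x : space) :=
  `| `|sum_on (~: upto k) x| ^+ 2 - (a ord_max - a k)|.
Let far (k : I) : set space := [set x | t <= dev k x].
Let exit (k : I) : set space :=
  [set x | 3 * t <= dev k x /\ forall j : I, (j < k)%N -> dev j x < 3 * t].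
Let tail_far (k : I) : set space := [set x | 2 * t <= tail k x].

Hypothesis farp : forall k, (Q (far k) <= p%:E)%E.

Let upto_max : upto ord_max = [set: I]%SET.
Proof. by apply/finset.setP => i; rewrite !inE -ltnS ltn_ord. Qed.

Let measurable_sqdev (J K : {set I}) (c : R) : J \subset K ->
  measurable_fun setT
    (fun x : g_sigma_algebraType (@cylinders _ (borel H) I K) =>
      `| `|sum_on J x| ^+ 2 - c|).
Proof.
move=> JK; apply: measurableT_comp => //; apply: measurable_funB => //.
apply: measurable_funX.
exact: (measurableT_comp (@measurable_norm_borel _ _)
  (measurable_sum_on sH JK)).
Qed.

Let measurable_ge (K : {set I}) (c : R)
    (f : g_sigma_algebraType (@cylinders _ (borel H) I K) -> R) :
  measurable_fun setT f -> measurable [set x | c <= f x].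
Proof.
move=> mf; rewrite -[X in measurable X]setTI.
have := @measurable_fun_ler _ _ _ setT (cst c) f.
move=> /(_ _ mf measurableT [set true]); apply => //.
Qed.

(** Only partial sums up to [k] enter. With [K] equal to [upto k] this makes [exit k] independent of
    events on the later coordinates. *)
Let measurable_exit k (K : {set I}) : upto k \subset K ->
  (@cylinders _ (borel H) I K).-sigma.-measurable (exit k).
Proof.
move=> kK.
rewrite [X in measurable X](_ : _ = [set x | 3 * t <= dev k x] `&`
    \bigcap_(j in [set j : I | (j < k)%N]) ~` [set x | 3 * t <= dev j x]).
  apply: measurableI; first by apply: measurable_ge; exact: measurable_sqdev.
  apply: fin_bigcap_measurable => [|j jk]; first exact: finite_finset.
  apply: measurableC.
  apply: measurable_ge; apply: measurable_sqdev; apply: fintype.subset_trans kK.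
  apply/fintype.subsetP => i; rewrite !inE => ij.
  exact: leq_trans ij (ltnW jk).
apply/seteqP; split => x [xk xj]; split => // j jk.
  by apply/negP; rewrite -ltNge; exact: xj.
by rewrite ltNge; apply/negP; exact: xj.
Qed.

Let mexit k : measurable (exit k).
Proof. by apply: measurable_exit; exact: finset.subsetT. Qed.

Let mfar k : measurable (far k).
Proof.
by apply: measurable_ge; apply: measurable_sqdev; exact: finset.subsetT.
Qed.

Let mtail_far k : measurable (tail_far k).
Proof.
by apply: measurable_ge; apply: measurable_sqdev; exact: finset.subsetT.
Qed.

Let mflip k (A : set space) : measurable A ->
  measurable (flip_off (upto k) @^-1` A : set space).
Proof.
by move=> mA; rewrite -[X in measurable X]setTI; exact: measurable_flip_off.
Qed.

Let reflection k (x : space) :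
  `|sum_on (upto ord_max) x| ^+ 2 +
  `|sum_on (upto ord_max) (flip_off (upto k) x)| ^+ 2 =
  2 * (`|sum_on (upto k) x| ^+ 2 + `|sum_on (~: upto k) x| ^+ 2).
Proof.
rewrite upto_max !(sum_on_setC (upto k)) sum_on_flip// sum_on_flipC.
exact: parallelogram.
Qed.

Let tail_farp k : (Q (tail_far k) <= (3 * p)%:E)%E.
Proof.
(* One [p] each for [far k], [far ord_max] and the flipped [far ord_max], the last having the same
   measure by [Qsym]. *)
have -> : 3 * p = p + (p + p) by ring.
apply: (@le_trans _ _ (Q (far k `|`
    (far ord_max `|` flip_off (upto k) @^-1` far ord_max)))).
  apply: le_measure; rewrite ?inE//.
    by apply: measurableU => //; apply: measurableU => //; exact: mflip.
  move=> x /(tail_deviation (reflection k x)) [?|?|?]; first by left.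
    by right; left.
  by right; right.
rewrite !EFinD; apply: (le_trans (measureU2 Q _ _)) => //.
  by apply: measurableU => //; exact: mflip.
apply: leeD; first exact: farp.
apply: (le_trans (measureU2 Q _ _)) => //; first exact: mflip.
apply: leeD; first exact: farp.
by have := farp ord_max; rewrite -(Qsym (upto k) (mfar ord_max)).
Qed.

(** The flip changes only coordinates after [k], on which [exit k] does not depend. *)
Let exit_flip k (x : space) : exit k (flip_off (upto k) x) <-> exit k x.
Proof.
have devE (j : I) : (j <= k)%N -> dev j (flip_off (upto k) x) = dev j x.
  move=> jk; rewrite /dev sum_on_flip//.
  by apply/fintype.subsetP => i; rewrite !inE => ij; exact: leq_trans jk.
rewrite /exit /= devE//; split => -[xk xj]; split => // j jk.
  by rewrite -devE ?xj// ltnW.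
by rewrite devE ?xj// ltnW.
Qed.

Let exitp k : (Q (exit k) <=
  (3 * p)%:E * Q (exit k) + 2%:E * Q (exit k `&` far ord_max))%E.
Proof.
have mEF : measurable (exit k `&` far ord_max) by exact: measurableI.
have indE : (Q (exit k `&` tail_far k) = Q (exit k) * Q (tail_far k))%E.
  apply: (@Qind (upto k)); first exact: measurable_exit.
  by apply: measurable_ge; exact: measurable_sqdev.
have splitE : (Q (exit k) =
    Q (exit k `\` tail_far k) + Q (exit k `&` tail_far k))%E.
  exact: measureDI.
rewrite [leLHS]splitE indE addeC muleC; apply: leeD.
  by rewrite lee_wpmul2r// tail_farp.
(* Reflected copy of the event: it has the same measure by [Qsym], whence the factor 2. *)
pose G : set space := flip_off (upto k) @^-1` (exit k `&` far ord_max).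
have mG : measurable G by exact: mflip.
have -> : (2%:E * Q (exit k `&` far ord_max) =
    Q (exit k `&` far ord_max) + Q G)%E.
  by rewrite (Qsym (upto k) mEF) -[2%:E]/(1 + 1)%:E EFinD ge0_muleDl// !mul1e.
apply: le_trans (measureU2 Q mEF mG); apply: le_measure; rewrite ?inE//.
- exact: measurableD.
- exact: measurableU.
- move=> x [xk /negP]; rewrite -ltNge => xF.
  have [?|?] := exit_deviation (reflection k x) xk.1 xF; first by left.
  by right; split => //; exact/exit_flip.
Qed.

Lemma sqnorm_maximal_inequality :
  (Q [set x | exists k, (3 * t <= dev k x)%R] <= (5 * p)%:E)%E.
Proof.
have texit : trivIset setT exit.
  apply/trivIsetP => i j _ _ ij; apply/seteqP; split => // x.
  move=> [[xi xi'] [xj xj']].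
  move: ij; rewrite neq_ltn => /orP[/xj'|/xi']; rewrite ltNge.
    by rewrite xi.
  by rewrite xj.
have -> : [set x | exists k, 3 * t <= dev k x] = \big[setU/set0]_k exit k.
  rewrite -bigcup_seq; apply/seteqP; split => x; last first.
    by move=> [k _ [xk _]]; exists k.
  move=> [k xk].
  (* The least index with a large deviation is the one whose exit event contains [x]. *)
  have [j xj jmin] := @arg_minnP I k (fun k => 3 * t <= dev k x) val xk.
  exists j => //=; first by rewrite mem_index_enum.
  split => // i ij; rewrite ltNge; apply/negP => /jmin.
  by rewrite leqNgt ij.
rewrite measure_bigsetU_ord//.
apply: (@le_trans _ _
    (\sum_k ((3 * p)%:E * Q (exit k) + 2%:E * Q (exit k `&` far ord_max))))%E.
  by apply: lee_sum => k _; exact: exitp.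
have p0 : 0 <= p by rewrite -lee_fin (le_trans _ (farp ord0)).
rewrite big_split/= -!ge0_sume_distrr// -!measure_bigsetU_ord//; last 2 first.
- by move=> k; exact: measurableI.
- exact: trivIset_setIr.
(* The exit events are disjoint: their union has measure at most 1, and its part inside
   [far ord_max] at most [p]. *)
apply: (@le_trans _ _ ((3 * p)%:E * 1 + 2%:E * p%:E))%E; last first.
  by rewrite mule1 -EFinM -EFinD lee_fin; lra.
apply: leeD.
  rewrite lee_wpmul2l//; first by rewrite lee_fin mulr_ge0.
  by apply: probability_le1; exact: bigsetU_measurable.
rewrite lee_wpmul2l// (le_trans _ (farp ord_max))//.
apply: le_measure; rewrite ?inE//.
  by apply: bigsetU_measurable => k _; exact: measurableI.
by rewrite -big_distrl/=; exact: subIsetr.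
Qed.

End maximal_inequality.

(** * The joint law of the variables: independence and flip invariance *)

Section law_of_family.
Context (R : realType) d (T : measurableType d) (P : probability T R).
Context (H : completeNormedModType R) (I : finType).
Variable X : I -> {RV P >-> borel H}.
Hypothesis Xind : mutually_independent X.
Hypothesis Xsym : forall i, symmetric_RV (X i).

Let space := g_sigma_algebraType (@cylinders _ (borel H) I [set: I]).

Definition family (w : T) : space := X^~ w.

Let measurable_fun_family : measurable_fun setT family.
Proof.
apply: (@measurable_family _ (borel H) I [set: I] _ T (fun i => X i)) => i.
exact: measurable_funPT.
Qed.

HB.instance Definition _ :=
  isMeasurableFun.Build _ _ _ _ family measurable_fun_family.

Definition family_law : probability space R := distribution P family.

Let law_cylinder (J : {set I}) (B : I -> set (borel H)) :
  (forall i, measurable (B i)) ->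
  family_law (cylinder J B) = (\prod_(i in J) P (X i @^-1` B i))%E.
Proof. by move=> mB; rewrite -Xind. Qed.

Lemma family_law_indep (J : {set I}) (A B : set space) :
  <<s cylinders J >> A -> <<s cylinders (~: J) >> B ->
  (family_law (A `&` B) = family_law A * family_law B)%E.
Proof.
have cylm K : cylinders K `<=` @measurable _ space.
  move=> C KC; apply: sub_sigma_algebra; apply: sub_cylinders KC.
  exact: finset.subsetT.
apply: (indep_g_sigma (P := family_law)); [exact: cylm|exact: cylinders_setI|
  exact: cylinders_setT|exact: cylm|exact: cylinders_setI|
  exact: cylinders_setT|].
move=> _ _ [C mC <-] [D mD <-].
(* The two sets of constraints concern disjoint coordinates, so they merge into one full cylinder,
   whose product formula then splits along [J]. *)
pose E i := if i \in J then C i else D i.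
have mE i : measurable (E i) by rewrite /E; case: ifP.
have -> : cylinder J C `&` cylinder (~: J) D = cylinder [set: I] E.
  apply/seteqP; split => [x [Cx Dx] i _|x Ex].
    rewrite /E; case: ifPn => iJ; first exact: Cx.
    by apply: Dx; rewrite inE.
  split => i iJ; have := Ex i (finset.in_setT i); rewrite /E.
    by rewrite iJ.
  by move: iJ; rewrite inE => /negbTE ->.
rewrite !law_cylinder// (bigID (mem J))/=; congr (_ * _)%E.
  apply: eq_big => i; first by rewrite inE.
  by rewrite /E inE /= => ->.
apply: eq_big => i; first by rewrite !inE.
by rewrite /E inE /= => /negbTE ->.
Qed.

(** By uniqueness of measures it is enough to compare the two laws on full cylinders, where the
    symmetry of each variable can be used factor by factor. *)
Lemma family_law_flip (J : {set I}) (A : set space) :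
  measurable A -> family_law (flip_off J @^-1` A) = family_law A.
Proof.
move=> mA; pose flip_mfun : {mfun space >-> space} := HB.pack
  (flip_off J : space -> space)
  (isMeasurableFun.Build _ _ _ _ _ (@measurable_flip_off _ H I J)).
rewrite -[LHS]/(distribution family_law flip_mfun A).
apply: (@measure_unique _ R space (@cylinders _ (borel H) I [set: I])
  (fun=> setT) _ _ _ _ (distribution family_law flip_mfun) family_law) => //.
- exact: cylinders_setI.
- by move=> _; exact: cylinders_setT.
- by rewrite bigcup_const.
- move=> _ [B mB <-].
  (* The preimage of a cylinder under the flip is the cylinder with the sets outside [J] reflected
     through 0. *)
  pose C i := if i \in J then B i else (fun h : H => - h) @^-1` B i.
  have mC i : measurable (C i).
    rewrite /C; case: ifP => // _; rewrite -[X in measurable X]setTI.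
    exact: (continuous_measurable_borel (@oppr_continuous _ H)).
  transitivity (family_law (cylinder [set: I] C)).
    congr (family_law _); apply/seteqP; split => x Bx i iI; have := Bx i iI;
      by rewrite /C /= /flip_off; case: ifP.
  rewrite [LHS]law_cylinder// [RHS]law_cylinder//.
  apply: eq_bigr => i _.
  rewrite /C; case: ifP => // _; exact/esym/(Xsym i (mB i)).
- by move=> _; rewrite ltey_eq fin_num_measure.
Qed.

End law_of_family.

(* Both maxima run over a nonempty family of nonnegative numbers, so the
   default value 0 does not alter them. *)
Theorem proposition1p2 (R : realType) (d : measure_display)
  (T : measurableType d) (P : probability T R)
  (H : completeNormedModType R) (hH : hilbert H) (sH : separable H)
  (n : nat) (hn : (1 <= n)%N) (X : 'I_n -> {RV P >-> borel H})
  (Xind : mutually_independent X) (Xsym : forall i : 'I_n, symmetric_RV (X i))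
  (a : 'I_n -> R) (t : R) (ht : 0 <= t) :
  (P [set w | (3 * t <= \big[Num.max/0]_(k < n)
                          `| `|partial_sum X k w| ^+ 2 - a k |)%R]
   <= 6%:E * \big[maxe/0]_(k < n)
               P [set w | (t <= `| `|partial_sum X k w| ^+ 2 - a k |)%R])%E.
Proof.
case: n hn X Xind Xsym a => // n _ X Xind Xsym a.
set m := (\big[maxe/0]_(k < n.+1) _)%E.
have sumE (k : 'I_n.+1) w : sum_on [set i : 'I_n.+1 | (i <= k)%N] (family X w) =
    partial_sum X k w.
  by apply: eq_bigl => i; rewrite inE.
have far (k : 'I_n.+1) : (family_law X
    [set x | (t <= `| `|sum_on [set i : 'I_n.+1 | (i <= k)%N] x| ^+ 2 - a k|)%R]
    <= m)%E.
  apply: le_trans (le_bigmax _ _ k).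
  rewrite le_eqVlt; apply/orP; left; apply/eqP.
  by congr (P _); apply/seteqP; split => w; rewrite /= sumE.
have m_ge0 : (0 <= m)%E by exact: bigmax_ge_id.
(* [m] is an extended real: the bound is trivial at [+oo], and [m_ge0] excludes [-oo]. *)
move: m far m_ge0 => [p far|_ _|//]; last by rewrite gt0_muley ?lte_fin ?leey.
rewrite lee_fin => p0.
have := sqnorm_maximal_inequality hH sH (family_law_flip Xind Xsym)
  (family_law_indep Xind) far.
have -> : [set w | 3 * t <= \big[Num.max/0]_(k < n.+1)
      `| `|partial_sum X k w| ^+ 2 - a k |] =
    family X @^-1` [set x | exists k : 'I_n.+1, 3 * t <=
      `| `|sum_on [set i : 'I_n.+1 | (i <= k)%N] x| ^+ 2 - a k|].
  apply/seteqP; split => w /=.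
    (* If the default 0 already reaches [3 * t], any index will do, since deviations are
       nonnegative. *)
    move=> /bigmax_geP[t0|[k _ tk]]; last by exists k; rewrite sumE.
    by exists ord0; exact: le_trans t0 (normr_ge0 _).
  by move=> [k]; rewrite sumE => /le_trans; apply; exact: le_bigmax.
(* The bound obtained is [5 * p], which is at most [6 * p] by [p0]. *)
move=> /le_trans; apply; rewrite -EFinM lee_fin; lra.
Qed.
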